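(* Let $C$ and $B$ be groups, $G = C * B$ their free product, $D$ the kernel of the natural homomorphism $C * B \to C \times B$, and $A = \langle C, D \rangle \le G$, so that $G = AB$ and $A \cap B = 1$. Let $(G, \cdot, \circ)$ be the skew left brace with $$(a_1 b_1) \circ (a_2 b_2) = a_1 a_2 b_2 b_1, \qquad a_1, a_2 \in A,\ b_1, b_2 \in B.$$ If $B$ is abelian, then $(G, \cdot, \circ)$ is $\lambda$-homomorphic.
   Context: A skew left brace is a triple $(G, \cdot, \circ)$ where $(G,\cdot)$ and $(G,\circ)$ are groups and $g_1 \circ (g_2 \cdot g_3) = (g_1 \circ g_2)\cdot g_1^{-1} \cdot (g_1 \circ g_3)$ for all $g_1,g_2,g_3 \in G$, where $g_1^{-1}$ is the inverse in $(G,\cdot)$. For $a \in G$ the map $\lambda_a : b \mapsto a^{-1}\cdot(a \circ b)$ is an automorphism of $(G,\cdot)$. The skew left brace is $\lambda$-homomorphic if the map $\lambda : (G,\cdot) \to \operatorname{Aut}(G,\cdot)$, $a \mapsto \lambda_a$, is a group homomorphism. Since $G = AB$ and $A \cap B = 1$, every element of $G$ is uniquely of the form $ab$ with $a \in A$, $b \in B$, so $\circ$ is well defined on $G$. *)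

(* Defs.v *)
From HB Require Import structures.
From mathcomp Require Import all_boot.
From mathcomp Require Import boolp classical_sets.

Set Implicit Arguments.
Unset Strict Implicit.
Unset Printing Implicit Defensive.
Set Warnings "-redundant-canonical-projection".

Local Open Scope quotient_scope.
Local Open Scope classical_set_scope.
Local Open Scope group_scope.

(* The free product C * B is the set of words in the letters C + B, modulo the
   least congruence for concatenation that identifies the letters 1 with the
   empty word and multiplies adjacent letters of the same factor. *)
Section FreeProduct.
Variables C B : groupType.

Inductive word_eq : seq (C + B) -> seq (C + B) -> Prop :=
| word_eq_refl u : word_eq u u
| word_eq_sym u v : word_eq u v -> word_eq v u
| word_eq_trans u v w : word_eq u v -> word_eq v w -> word_eq u w
| word_eq_cat u u' v v' :
    word_eq u u' -> word_eq v v' -> word_eq (u ++ v) (u' ++ v')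
| word_eq_1l : word_eq [:: inl 1] [::]
| word_eq_1r : word_eq [:: inr 1] [::]
| word_eq_Ml x y : word_eq [:: inl x; inl y] [:: inl (x * y)]
| word_eq_Mr x y : word_eq [:: inr x; inr y] [:: inr (x * y)].

Definition word_eqb : rel (seq (C + B)) := fun u v => `[< word_eq u v >].

Lemma word_eqb_refl : reflexive word_eqb.
Proof. by move=> u; apply/asboolP/word_eq_refl. Qed.

Lemma word_eqb_sym : symmetric word_eqb.
Proof. by move=> u v; apply/asboolP/asboolP => /word_eq_sym. Qed.

Lemma word_eqb_trans : transitive word_eqb.
Proof.
move=> v u w /asboolP uv /asboolP vw.
by apply/asboolP; apply: word_eq_trans uv vw.
Qed.

Canonical word_equiv := EquivRel word_eqb word_eqb_refl word_eqb_sym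
  word_eqb_trans.

Definition free_product := {eq_quot word_equiv}.

HB.instance Definition _ := Choice.on free_product.
HB.instance Definition _ := Quotient.on free_product.

Definition fp_class (u : seq (C + B)) : free_product :=
  \pi_({eq_quot word_equiv}) u.

Lemma fp_classK : cancel (@repr _ free_product) fp_class.
Proof. exact: reprK. Qed.

Lemma fp_piP u v : fp_class u = fp_class v <-> word_eq u v.
Proof.
by split=> [/eqmodP/asboolP //| uv]; apply/eqmodP/asboolP.
Qed.

Lemma fp_reprP u : word_eq (repr (fp_class u)) u.
Proof. by apply/fp_piP; rewrite fp_classK. Qed.

Definition letter_inv (l : C + B) : C + B :=
  match l with inl x => inl x^-1 | inr y => inr y^-1 end.

Definition word_inv (u : seq (C + B)) := rev (map letter_inv u).

Definition fp_one : free_product := fp_class [::].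
Definition fp_mul (g h : free_product) : free_product :=
  fp_class (repr g ++ repr h).
Definition fp_inv (g : free_product) : free_product :=
  fp_class (word_inv (repr g)).

Lemma fp_mul_pi u v : fp_mul (fp_class u) (fp_class v) = fp_class (u ++ v).
Proof. by apply/fp_piP; apply: word_eq_cat; apply: fp_reprP. Qed.

Lemma word_mulV u : word_eq (u ++ word_inv u) [::].
Proof.
elim: u => [|l u IH]; first exact: word_eq_refl.
have -> : (l :: u) ++ word_inv (l :: u) =
          [:: l] ++ (u ++ word_inv u) ++ [:: letter_inv l].
  by rewrite /word_inv /= rev_cons -cats1 catA.
apply: (@word_eq_trans _ ([:: l] ++ [::] ++ [:: letter_inv l])).
  apply: word_eq_cat; first exact: word_eq_refl.
  by apply: word_eq_cat => //; apply: word_eq_refl.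
case: l => x /=.
  by apply: word_eq_trans (word_eq_Ml _ _) _; rewrite mulgV; apply: word_eq_1l.
by apply: word_eq_trans (word_eq_Mr _ _) _; rewrite mulgV; apply: word_eq_1r.
Qed.

Lemma word_invK : involutive word_inv.
Proof.
move=> u; rewrite /word_inv map_rev revK -map_comp -[RHS]map_id.
by apply: eq_map => -[x|x] /=; rewrite invgK.
Qed.

Lemma fp_mulA : associative fp_mul.
Proof.
move=> f g h; rewrite -[f]fp_classK -[g]fp_classK -[h]fp_classK.
by rewrite !fp_mul_pi catA.
Qed.

Lemma fp_mul1 : left_id fp_one fp_mul.
Proof. by move=> g; rewrite -[g]fp_classK fp_mul_pi. Qed.

Lemma fp_mulr1 : right_id fp_one fp_mul.
Proof. by move=> g; rewrite -[g]fp_classK fp_mul_pi cats0. Qed.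

Lemma fp_mulrV : right_inverse fp_one fp_inv fp_mul.
Proof.
move=> g; rewrite -{1}[g]fp_classK fp_mul_pi.
by apply/fp_piP; apply: word_mulV.
Qed.

Lemma fp_mulV : left_inverse fp_one fp_inv fp_mul.
Proof.
move=> g; rewrite -{2}[g]fp_classK fp_mul_pi; apply/fp_piP.
by rewrite -{2}[repr g]word_invK; apply: word_mulV.
Qed.

HB.instance Definition _ := isGroup.Build free_product
  fp_mulA fp_mul1 fp_mulr1 fp_mulV fp_mulrV.

Definition fp_inl (x : C) : free_product := fp_class [:: inl x].
Definition fp_inr (y : B) : free_product := fp_class [:: inr y].

Lemma fp_inl_morph : monoid_morphism fp_inl.
Proof.
split; first by apply/fp_piP/word_eq_1l.
move=> x y; rewrite [RHS]fp_mul_pi.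
by apply/fp_piP/word_eq_sym/word_eq_Ml.
Qed.

Lemma fp_inr_morph : monoid_morphism fp_inr.
Proof.
split; first by apply/fp_piP/word_eq_1r.
move=> x y; rewrite [RHS]fp_mul_pi.
by apply/fp_piP/word_eq_sym/word_eq_Mr.
Qed.

HB.instance Definition _ := isUMagmaMorphism.Build C free_product fp_inl
  fp_inl_morph.
HB.instance Definition _ := isUMagmaMorphism.Build B free_product fp_inr
  fp_inr_morph.

Lemma fp_ind (P : free_product -> Prop) :
  P 1 -> (forall x g, P g -> P (fp_inl x * g)) ->
  (forall y g, P g -> P (fp_inr y * g)) -> forall g, P g.
Proof.
move=> P1 Pl Pr g; rewrite -[g]fp_classK; elim: (repr g) => [|[x|y] u IH] //.
  by have := Pl x _ IH; rewrite [_ * _]fp_mul_pi.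
by have := Pr y _ IH; rewrite [_ * _]fp_mul_pi.
Qed.

Section Lift.
Variables (H : groupType).
Variables (f : UMagmaMorphism.type C H) (g : UMagmaMorphism.type B H).

Definition word_lift (u : seq (C + B)) : H :=
  \prod_(l <- u) match l with inl x => f x | inr y => g y end.

Lemma word_lift_eq u v : word_eq u v -> word_lift u = word_lift v.
Proof.
rewrite /word_lift; elim=> {u v} //= [u v w _ -> //|u u' v v' _ IHu _ IHv||||].
- by rewrite !big_cat /= IHu IHv.
- by rewrite big_seq1 big_nil gmulf1.
- by rewrite big_seq1 big_nil gmulf1.
- by move=> x y; rewrite big_cons !big_seq1 gmulfM.
- by move=> x y; rewrite big_cons !big_seq1 gmulfM.
Qed.

Definition fp_lift (w : free_product) : H := word_lift (repr w).

Lemma fp_lift_pi u : fp_lift (fp_class u) = word_lift u.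
Proof. exact/word_lift_eq/fp_reprP. Qed.

Lemma fp_lift_morph : monoid_morphism fp_lift.
Proof.
split; first by rewrite fp_lift_pi /word_lift big_nil.
move=> v w; rewrite -[v]fp_classK -[w]fp_classK [_ * _ in LHS]fp_mul_pi.
by rewrite !fp_lift_pi /word_lift big_cat.
Qed.

HB.instance Definition _ := isUMagmaMorphism.Build free_product H fp_lift
  fp_lift_morph.

Lemma fp_lift_inl x : fp_lift (fp_inl x) = f x.
Proof. by rewrite fp_lift_pi /word_lift big_seq1. Qed.

Lemma fp_lift_inr y : fp_lift (fp_inr y) = g y.
Proof. by rewrite fp_lift_pi /word_lift big_seq1. Qed.

Lemma fp_lift_unique (k : UMagmaMorphism.type free_product H) :
  (forall x, k (fp_inl x) = f x) -> (forall y, k (fp_inr y) = g y) ->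
  forall w, k w = fp_lift w.
Proof.
move=> kl kr; elim/fp_ind => [|x w IH|y w IH]; first by rewrite !gmulf1.
  by rewrite !gmulfM IH kl; congr (_ * _); apply/esym/fp_lift_inl.
by rewrite !gmulfM IH kr; congr (_ * _); apply/esym/fp_lift_inr.
Qed.

End Lift.
End FreeProduct.

Section Subgroups.
Variable G : groupType.

Definition is_subgroup (H : set G) : Prop :=
  [/\ H 1, forall x y, H x -> H y -> H (x * y) & forall x, H x -> H x^-1].

Definition gen (S : set G) : set G := smallest is_subgroup S.

Lemma gen_subgroup (S : set G) : is_subgroup (gen S).
Proof.
split=> [|x y|x]; first by move=> H [[]].
- move=> Sx Sy H HS; case: (HS) => -[_ HM _] _.
  by apply: HM; [apply: Sx|apply: Sy].
- move=> Sx H HS; case: (HS) => -[_ _ HV] _.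
  by apply: HV; apply: Sx.
Qed.

End Subgroups.

Section Setting.
Variables C B : groupType.
Local Notation G := (free_product C B).

Definition prod_inl (x : C) : C * B := (x, 1).
Definition prod_inr (y : B) : C * B := (1, y).

Lemma prod_inl_morph : monoid_morphism prod_inl.
Proof. by split=> // x y; congr pair; rewrite /= mulg1. Qed.

Lemma prod_inr_morph : monoid_morphism prod_inr.
Proof. by split=> // x y; congr pair; rewrite /= mulg1. Qed.

HB.instance Definition _ := isUMagmaMorphism.Build C (C * B)%type prod_inl
  prod_inl_morph.
HB.instance Definition _ := isUMagmaMorphism.Build B (C * B)%type prod_inr
  prod_inr_morph.

Definition fp_to_prod : UMagmaMorphism.type G (C * B)%type :=
  fp_lift prod_inl prod_inr.

Definition fpC : set G := range (@fp_inl C B).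
Definition fpB : set G := range (@fp_inr C B).
Definition fpD : set G := [set g | fp_to_prod g = 1].
Definition fpA : set G := gen (fpC `|` fpD).

Definition fp_beta (g : G) : B := (fp_to_prod g).2.

Lemma fp_betaM : {morph fp_beta : g h / g * h}.
Proof. by move=> g h; rewrite /fp_beta gmulfM. Qed.

Lemma fp_beta1 : fp_beta 1 = 1.
Proof. by rewrite /fp_beta gmulf1. Qed.

Lemma fp_betaV g : fp_beta g^-1 = (fp_beta g)^-1.
Proof. by rewrite /fp_beta gmulfV. Qed.

Lemma fp_beta_inr y : fp_beta (fp_inr C y) = y.
Proof. by rewrite /fp_beta [fp_to_prod _]fp_lift_inr. Qed.

Lemma fpAE g : fpA g <-> fp_beta g = 1.
Proof.
split=> [Ag|bg].
  apply: (Ag [set h | fp_beta h = 1]); split.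
    split=> [|x y|x] /=; first exact: fp_beta1.
      by move=> xE yE; rewrite fp_betaM xE yE mulg1.
    by move=> xE; rewrite fp_betaV xE invg1.
  move=> x [[z _ <-]|/= xD]; last by rewrite /= /fp_beta xD.
  by rewrite /= /fp_beta [fp_to_prod _]fp_lift_inl.
have [_ AM _] := gen_subgroup (fpC `|` fpD).
pose c := fp_inl B (fp_to_prod g).1.
rewrite -(mulVKg c g); apply: AM => H [_ sH]; apply: sH.
  by left; exists (fp_to_prod g).1.
right; change (fp_to_prod (c^-1 * g) = 1).
rewrite gmulfM gmulfV [fp_to_prod c]fp_lift_inl.
rewrite [X in _ * X](_ : _ = prod_inl (fp_to_prod g).1) ?mulVg //.
by rewrite [LHS]surjective_pairing -/(fp_beta g) bg.
Qed.

Lemma fpA_fpB g : exists a b, [/\ fpA a, fpB b & g = a * b].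
Proof.
exists (g * (fp_inr C (fp_beta g))^-1), (fp_inr C (fp_beta g)).
split; last by rewrite mulgVK.
  by apply/fpAE; rewrite fp_betaM fp_betaV fp_beta_inr mulgV.
by exists (fp_beta g).
Qed.

Lemma fpA_fpB_trivial : fpA `&` fpB = [set 1].
Proof.
apply/seteqP; split=> [g [/fpAE bg [y _ gE]]|g -> /=].
  by move: bg; rewrite -gE fp_beta_inr => ->; apply: gmulf1.
by split; [apply/fpAE/fp_beta1|exists 1 => //; apply: gmulf1].
Qed.

End Setting.

Section Automorphisms.
Variable G : groupType.

Record automorphism := Automorphism {
  aut_fun :> G -> G;
  aut_bij : bijective aut_fun;
  autM : {morph aut_fun : x y / x * y}
}.

HB.instance Definition _ := gen_eqMixin automorphism.
HB.instance Definition _ := gen_choiceMixin automorphism.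

Lemma autP (f g : automorphism) : (forall x, f x = g x) -> f = g.
Proof.
case: f g => [f fb fM] [g gb gM] /= fg.
have {}fg : f = g by apply: funext.
rewrite -{}fg in gb gM *.
by rewrite (Prop_irrelevance fb gb) (Prop_irrelevance fM gM).
Qed.

Definition aut_one : automorphism :=
  @Automorphism id (Bijective (fun=> erefl) (fun=> erefl)) (fun _ _ => erefl).

Lemma aut_mul_morph (f g : automorphism) :
  {morph (f : G -> G) \o g : x y / x * y}.
Proof. by move=> x y /=; rewrite !autM. Qed.

Definition aut_mul (f g : automorphism) : automorphism :=
  Automorphism (bij_comp (aut_bij f) (aut_bij g)) (aut_mul_morph f g).

Lemma aut_surj (f : automorphism) (y : G) : exists x, f x = y.
Proof. by case: (aut_bij f) => f' _ f'K; exists (f' y). Qed.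

Definition aut_inv_fun (f : automorphism) (y : G) : G :=
  sval (cid (aut_surj f y)).

Lemma aut_inv_funK (f : automorphism) : cancel (aut_inv_fun f) f.
Proof. by move=> y; rewrite /aut_inv_fun; case: cid. Qed.

Lemma aut_funK (f : automorphism) : cancel f (aut_inv_fun f).
Proof. by move=> x; apply: (bij_inj (aut_bij f)); rewrite aut_inv_funK. Qed.

Lemma aut_inv_morph f : {morph aut_inv_fun f : x y / x * y}.
Proof.
move=> x y; apply: (bij_inj (aut_bij f)).
by rewrite autM !aut_inv_funK.
Qed.

Definition aut_inv (f : automorphism) : automorphism :=
  Automorphism (Bijective (aut_inv_funK f) (aut_funK f)) (aut_inv_morph f).

Lemma aut_mulA : associative aut_mul.
Proof. by move=> f g h; apply: autP. Qed.

Lemma aut_mul1 : left_id aut_one aut_mul.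
Proof. by move=> f; apply: autP. Qed.

Lemma aut_mulr1 : right_id aut_one aut_mul.
Proof. by move=> f; apply: autP. Qed.

Lemma aut_mulV : left_inverse aut_one aut_inv aut_mul.
Proof. by move=> f; apply: autP => x /=; rewrite aut_funK. Qed.

Lemma aut_mulrV : right_inverse aut_one aut_inv aut_mul.
Proof. by move=> f; apply: autP => x /=; rewrite aut_inv_funK. Qed.

HB.instance Definition _ := isGroup.Build automorphism
  aut_mulA aut_mul1 aut_mulr1 aut_mulV aut_mulrV.

End Automorphisms.

Definition is_group_law (T : Type) (op : T -> T -> T) : Prop :=
  exists (e : T) (inv : T -> T),
    [/\ associative op, left_id e op, right_id e op,
        left_inverse e inv op & right_inverse e inv op].

Record skew_left_brace (G : groupType) := SkewLeftBrace {
  circ : G -> G -> G;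
  circ_group : is_group_law circ;
  circ_brace : forall x y z : G, circ x (y * z) = circ x y * x^-1 * circ x z
}.

Section Lambda.
Variables (G : groupType) (S : skew_left_brace G).

Definition lambda_fun (a b : G) : G := a^-1 * circ S a b.

Lemma lambda_fun_morph a : {morph lambda_fun a : x y / x * y}.
Proof. by move=> x y; rewrite /lambda_fun circ_brace !mulgA. Qed.

Lemma lambda_fun_bij a : bijective (lambda_fun a).
Proof.
have [e [inv [cA c1 _ cV cr]]] := circ_group S.
exists (fun y => circ S (inv a) (a * y)) => y; rewrite /lambda_fun.
  by rewrite mulVKg cA cV c1.
by rewrite cA cr c1 mulKg.
Qed.

Definition lambda (a : G) : automorphism G :=
  Automorphism (lambda_fun_bij a) (lambda_fun_morph a).

Definition lambda_homomorphic : Prop := {morph lambda : a b / a * b}.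

End Lambda.

(* The product formula does define a skew left brace on C * B, and only one. *)
Section Existence.
Variables C B : groupType.
Local Notation G := (free_product C B).

Definition circ_formula (op : G -> G -> G) : Prop :=
  forall a1 a2 b1 b2 : G, fpA a1 -> fpA a2 -> fpB b1 -> fpB b2 ->
    op (a1 * b1) (a2 * b2) = a1 * a2 * b2 * b1.

Lemma circ_formula_unique op1 op2 :
  circ_formula op1 -> circ_formula op2 -> op1 = op2.
Proof.
move=> op1P op2P; apply: funext => g; apply: funext => h.
have [a1 [b1 [Aa1 Bb1 ->]]] := fpA_fpB g.
have [a2 [b2 [Aa2 Bb2 ->]]] := fpA_fpB h.
by rewrite op1P ?op2P.
Qed.

Let beta (g : G) : G := fp_inr C (fp_beta g).
Let op (g h : G) : G := g * h ^ beta g.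

Let betaM g h : beta (g * h) = beta g * beta h.
Proof. by rewrite /beta fp_betaM gmulfM. Qed.

Let betaV g : beta g^-1 = (beta g)^-1.
Proof. by rewrite /beta fp_betaV gmulfV. Qed.

Let beta_id g : beta (beta g) = beta g.
Proof. by rewrite /beta fp_beta_inr. Qed.

Let beta1 : beta 1 = 1.
Proof. by rewrite /beta fp_beta1 gmulf1. Qed.

Let betaJ g h : beta (h ^ beta g) = beta h ^ beta g.
Proof. by rewrite /conjg !betaM betaV beta_id. Qed.

Let op_group : is_group_law op.
Proof.
exists 1, (fun g => g^-1 ^ (beta g)^-1); split.
- move=> f g h; rewrite /op.
  have -> : beta (f * g ^ beta f) = beta g * beta f.
    by rewrite betaM betaJ [RHS]conjgC.
  by rewrite conjMg conjgM mulgA.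
- by move=> g; rewrite /op beta1 conjg1 mul1g.
- by move=> g; rewrite /op conj1g mulg1.
- move=> g; rewrite /op.
  have -> : beta (g^-1 ^ (beta g)^-1) = (beta g)^-1.
    by rewrite -betaV betaJ betaV conjgE mulKg.
  by rewrite -conjMg mulVg conj1g.
- by move=> g; rewrite /op conjgKV mulgV.
Qed.

Let op_brace x y z : op x (y * z) = op x y * x^-1 * op x z.
Proof. by rewrite /op conjMg -!mulgA mulKg. Qed.

Lemma circ_formula_exists :
  exists S : skew_left_brace G, circ_formula (circ S).
Proof.
exists (SkewLeftBrace op_group op_brace) => a1 a2 b1 b2 Aa1 Aa2 [y1 _ <-].
move=> [y2 _ <-].
have bE : beta (a1 * fp_inr C y1) = fp_inr C y1.
  by move/fpAE: Aa1; rewrite /beta fp_betaM => ->; rewrite fp_beta_inr mul1g.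
by rewrite [LHS]/(op _ _) /op bE conjgE !mulgA mulgK.
Qed.

End Existence.

(* Main.v *)
Require Import Defs.
From mathcomp Require Import all_boot.
From mathcomp Require Import boolp classical_sets.

(* [lambda g] is conjugation by the [B]-component [beta g] of [g]. As [beta] is
   a morphism, [lambda] is an anti-morphism, hence a morphism when [B] is
   abelian. *)

Local Open Scope group_scope.

(** For [g = a1 * b1] and [h = a2 * b2], the factor [a1] cancels in [g^-1 * (a1 * a2 * b2 * b1)],
    leaving [b1^-1 * h * b1]. *)

Lemma lambda_conj (C B : groupType) (S : skew_left_brace (free_product C B))
    (hS : circ_formula (circ S)) (g h : free_product C B) :
  lambda S g h = h ^ fp_inr C (fp_beta g).
Proof.
have [a1 [b1 [Aa1 Bb1 ->]]] := fpA_fpB g.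
have [a2 [b2 [Aa2 Bb2 ->]]] := fpA_fpB h.
(* [fpA] is the kernel of [fp_beta], so only [b1] contributes. *)
have -> : fp_inr C (fp_beta (a1 * b1)) = b1.
  move/fpAE: Aa1; rewrite fp_betaM => ->.
  by case: Bb1 => y _ <-; rewrite fp_beta_inr mul1g.
by rewrite /= /lambda_fun hS // invgM conjgE !mulgA mulgVK.
Qed.

Theorem proposition5p9 (C B : groupType)
    (S : skew_left_brace (free_product C B))
    (hS : forall a1 a2 b1 b2 : free_product C B,
      fpA a1 -> fpA a2 -> fpB b1 -> fpB b2 ->
      circ S (a1 * b1) (a2 * b2) = a1 * a2 * b2 * b1)
    (hB : forall x y : B, commute x y) :
  lambda_homomorphic S.
Proof.
move=> g h; apply: autP => x.
transitivity (lambda S g (lambda S h x)); last by [].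
rewrite !lambda_conj //.
(* Conjugation is a right action while automorphisms compose on the left, so the two [B]-components
   meet in opposite orders; [hB] swaps them. *)
by rewrite fp_betaM hB gmulfM conjgM.
Qed.
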